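(* Let $G$ be a graph of order $n$. If $\sigma_3(G)\geq n$ and every nonempty independent set $I$ of $G$ satisfies $|I|\leq \delta_G(I)-1$, then $G$ has a 2-factor with at most two cycles.
   Context: All graphs are simple, finite and undirected. The order of $G$ is its number of vertices. $d_G(v)$ denotes the degree of a vertex $v$ in $G$, and $\alpha(G)$ the independence number. For a nonempty independent set $I$ of $G$, $\delta_G(I):=\min\{d_G(v)\mid v\in I\}$. $\sigma_3(G):=\min\{\sum_{v\in I}d_G(v)\mid I \text{ is an independent set of } G \text{ with } |I|=3\}$ if $\alpha(G)\geq 3$, and $\sigma_3(G):=\infty$ otherwise. A 2-factor of a graph is a spanning 2-regular subgraph; its cycles are its connected components. *)

(* Defs.v *)
From mathcomp Require Import all_boot.
Set Implicit Arguments.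
Unset Strict Implicit.
Unset Printing Implicit Defensive.

Definition simple_graph (T : finType) (e : rel T) : Prop :=
  symmetric e /\ irreflexive e.

Section Graph.
Variables (T : finType) (e : rel T).

Definition degree (v : T) : nat := #|[set w | e v w]|.

Definition independent (I : {set T}) : bool :=
  [forall u in I, forall v in I, ~~ e u v].

Definition alpha : nat := \max_(I : {set T} | independent I) #|I|.

(* The default value #|T| bounds every degree, so this is the minimum degree
   over I as soon as I is nonempty (see delta_min). *)
Definition delta (I : {set T}) : nat := \big[minn/#|T|]_(v in I) degree v.

Definition degree_sum (I : {set T}) : nat := \sum_(v in I) degree v.

(* None stands for infinity.  The default value of the iterated minimum bounds
   every degree sum, so in the first branch, where some independent set of
   size 3 exists, this is the genuine minimum (see sigma3_min). *)
Definition sigma3 : option nat :=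
  if 3 <= alpha then
    Some (\big[minn/degree_sum [set: T]]_(I : {set T} |
            independent I && (#|I| == 3)) degree_sum I)
  else None.

End Graph.

(* A spanning subgraph is given by its edge relation f on the same vertices. *)
Definition two_factor (T : finType) (e f : rel T) : Prop :=
  [/\ simple_graph f, subrel f e & forall v, degree f v = 2].

(* n <= x in the naturals extended by None = infinity. *)
Definition leq_inf (n : nat) (x : option nat) : bool :=
  if x is Some m then n <= m else true.

(* The cycles of a 2-factor are its connected components. *)
Definition num_cycles (T : finType) (f : rel T) : nat := n_comp f predT.

Section Minima.
Variables (T : finType) (e : rel T).

Lemma bigminn_min (S : finType) (P : pred S) (F : S -> nat) d i0 :
  P i0 -> (forall i, P i -> F i <= d) ->
  (exists2 i, P i & \big[minn/d]_(i | P i) F i = F i) /\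
  (forall i, P i -> \big[minn/d]_(i | P i) F i <= F i).
Proof.
move=> Pi0 Fd.
have lb i : P i -> \big[minn/d]_(i | P i) F i <= F i.
  move=> Pi; have : i \in index_enum S by rewrite mem_index_enum.
  elim: (index_enum S) => // j s IH; rewrite inE big_cons => /orP[/eqP <-|/IH le_s].
    by rewrite Pi geq_minl.
  by case: ifP => // _; apply: leq_trans le_s; rewrite geq_minr.
split=> //.
have: \big[minn/d]_(i | P i) F i = d \/
      exists2 i, P i & \big[minn/d]_(i | P i) F i = F i.
  elim/big_rec: _ => [|i x Pi IH]; first by left.
  rewrite /minn; case: ltnP => _; last exact: IH.
  by right; exists i.
case=> // eq_d; exists i0 => //.
by apply/eqP; rewrite eqn_leq lb //= eq_d Fd.
Qed.

Lemma delta_min (I : {set T}) : I != set0 ->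
  (exists2 v, v \in I & delta e I = degree e v) /\
  (forall v, v \in I -> delta e I <= degree e v).
Proof.
by case/set0Pn=> v0 v0I; apply: (bigminn_min v0I) => v _; apply: max_card.
Qed.

Lemma sigma3_min m : sigma3 e = Some m ->
  (exists2 I : {set T}, independent e I && (#|I| == 3) & m = degree_sum e I) /\
  (forall I : {set T}, independent e I && (#|I| == 3) -> m <= degree_sum e I).
Proof.
rewrite /sigma3; case: ifP => // a3 [<-].
have [J iJ cJ] : exists2 J : {set T}, independent e J & alpha e = #|J|.
  have ind0 : independent e set0 by apply/forall_inP=> u; rewrite inE.
  by rewrite /alpha (bigmax_eq_arg set0) //; case: arg_maxnP => // J; exists J.
have /card_geqP[s [us s3 sJ]] : 3 <= #|J| by rewrite -cJ.
have P0 : independent e [set x in s] && (#|[set x in s]| == 3).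
  rewrite cardsE (card_uniqP us) s3 eqxx andbT.
  apply/forall_inP=> u; rewrite inE => /sJ uJ.
  apply/forall_inP=> v; rewrite inE => /sJ vJ.
  by move/forall_inP/(_ u uJ)/forall_inP/(_ v vJ): iJ.
apply: (@bigminn_min _ (fun I : {set T} => independent e I && (#|I| == 3))
          (degree_sum e) _ _ P0) => I _.
rewrite /degree_sum [leqRHS](bigID [in I]) /=.
under [X in _ <= X + _]eq_bigl => v do rewrite inE.
exact: leq_addr.
Qed.

Lemma sigma3_infinite : sigma3 e = None <-> alpha e < 3.
Proof. by rewrite /sigma3 (ltnNge (alpha e)); case: (3 <= alpha e); split. Qed.

End Minima.

(* Main.v *)
Require Import Defs.
From mathcomp Require Import all_boot zify.
Set Implicit Arguments.
Unset Strict Implicit.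
Unset Printing Implicit Defensive.

(** The hypotheses enter through two conditions: every vertex of an independent
    set [I] has degree greater than [#|I|], and the degrees of three pairwise
    nonadjacent vertices sum to at least the order.  Under these conditions a
    nonempty graph is covered by one cycle or by two disjoint cycles.

    Let [c] be a longest cycle and write w+ for the successor of [w] on [c].
    A detour is a path outside [c] joining two vertices [w], [z] of [c].
    Rerouting [c] along it would lengthen [c], so z <> w+, w+ and z+ are not
    adjacent, and, when the detour has at least two inner vertices, w+ and z++
    are not adjacent.  Hence the successors of the vertices attached to a
    connected set outside [c], together with one vertex of that set, are
    independent, and the first condition makes the degrees of these vertices
    large.

    The main step ([open_path_two_cycles]) concerns a path [P] outside [c], with
    ends [h], [v] having all their neighbours on [c] or [P], and no cycle on the
    vertex set of [P].  Let [W] be the set of neighbours of [h] or [v] on [c].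
    For [w] in [W], the vertices w+, [h], [v] are pairwise nonadjacent, and
    counting neighbours bounds their degree sum by the order minus one, plus one
    if [w] is adjacent to both ends.  So the second condition is tight: every vertex of
    [W] is adjacent to both ends, and w+ is adjacent to every vertex that the
    count allows; by symmetry the predecessor w- is adjacent to all vertices
    outside [c] and [P].  Two such adjacencies would lengthen [c], so [c] and [P]
    cover the graph.  If w+ and w- are adjacent for some w, then [c] without [w]
    and [P] with [w] are the two cycles wanted.  Otherwise tightness forces w-
    to be z++ with z in [W], so [c] consists of [W], its successors and their
    successors, and the neighbours of w+ all lie in [W] or equal w++, which is
    too few.

    So one may assume that a longest path outside [c] spans a cycle [D1], which
    is then a connected component of the rest, and, if [c] and [D1] do not cover
    the graph, that a longest path outside both spans a second such component
    [D2].  This is absurd ([no_two_components]): a vertex attached to [D1] whose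
    successor is not attached to [D2] forces, by the degree sum, more attached
    vertices for [D2] than for [D1]; this cannot hold in both directions, and
    the remaining cases give a longer cycle or a small degree sum. *)

(** * Cycles, paths and detours *)

Section Cycles.
Variables (T : finType) (e : rel T).
Hypotheses (esym : symmetric e) (eirr : irreflexive e).
Implicit Types (c p q s : seq T) (w x y z : T) (W : {set T}).

Definition graph_cycle c := [&& 2 < size c, uniq c & cycle e c].

Definition two_cycles := exists c1 c2 : seq T,
  [/\ graph_cycle c1, graph_cycle c2 || nilp c2, uniq (c1 ++ c2) &
      forall x, x \in c1 ++ c2].

(** Quantifying over tuples keeps this boolean, for use in case distinctions. *)
Definition closes_up s := [exists t : (size s).-tuple T, graph_cycle t && perm_eq t s].

Lemma closes_upP s : reflect (exists2 c, graph_cycle c & perm_eq c s) (closes_up s).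
Proof.
apply: (iffP existsP) => [[t /andP[ct ts]]|[c cc cs]]; first by exists t.
have sz : size c == size s by rewrite (perm_size cs).
by exists (Tuple sz); rewrite /= cc.
Qed.

Lemma longest_seq (Q : pred (seq T)) s0 : Q s0 -> (forall s, Q s -> uniq s) ->
  exists2 s, Q s & forall s', Q s' -> size s' <= size s.
Proof.
move=> Qs0 Quniq.
pose has_size k := [exists t : k.-tuple T, Q t].
have has_sizeP s : Q s -> has_size (size s).
  by move=> Qs; apply/existsP; exists (in_tuple s).
have ubound k : has_size k -> k <= #|T|.
  move=> /existsP[t /Quniq/card_uniqP]; rewrite size_tuple => <-.
  exact: max_card.
have ex_size : exists k, has_size k by exists (size s0); apply: has_sizeP.
case: (ex_maxnP ex_size ubound) => k /existsP[t Qt] kmax.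
by exists t => // s' /has_sizeP/kmax; rewrite size_tuple.
Qed.

Lemma path_rev x p y : path e x (rcons p y) = path e y (rcons (rev p) x).
Proof.
rewrite -(eq_path (e := fun a b => e b a)) => [|a b]; last exact: esym.
by rewrite -rev_path last_rcons belast_rcons rev_cons.
Qed.

(** The cycle left when the arcs [a :: A] and [b :: B] of a cycle are reconnected
    crosswise: first to first through [q], last to last through [p]. *)
Lemma cycle_of_detours a A q b B p : path e a A -> path e b B -> path e a (rcons q b) ->
  path e (last b B) (rcons p (last a A)) -> cycle e (a :: q ++ b :: B ++ p ++ rev A).
Proof.
move=> pA pB pq pp.
have -> : cycle e (a :: q ++ b :: B ++ p ++ rev A) =
    path e a (rcons q b ++ B ++ rcons p (last a A) ++ rev (belast a A)).
  rewrite /= !cat_rcons !rcons_cat /= !rcons_cat -rev_cons.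
  by rewrite (lastI a A) rev_rcons.
rewrite !cat_path pq last_rcons pB pp last_rcons /=.
rewrite (eq_path (e' := fun a b => e b a)) => [|x y]; last exact: esym.
by rewrite rev_path.
Qed.

Lemma perm_cycle_of_detours a A q b B p c : perm_eq (a :: A ++ b :: B) c ->
  perm_eq (a :: q ++ b :: B ++ p ++ rev A) (c ++ p ++ q).
Proof.
move=> /permP perm_AB; apply/permP => P; rewrite !count_cat -perm_AB.
by rewrite /= !count_cat /= !count_cat count_rev; lia.
Qed.

(** Recording adjacency and succession in one relation lets both survive any
    rotation and cutting of [c]. *)
Lemma cycle_edge_next c : uniq c -> cycle e c ->
  cycle [rel x y | e x y && (next c x == y)] c.
Proof.
by move=> uc ec; rewrite cycle_relI ec; apply: cycle_next.
Qed.

Lemma next_inj c : uniq c -> injective (next c).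
Proof. by move=> /prev_next/can_inj. Qed.

Lemma cycle_open c w : graph_cycle c -> w \in c ->
  exists s, [/\ perm_eq (next c w :: s) c, path e (next c w) s,
    path (frel (next c)) (next c w) s & last (next c w) s = w].
Proof.
case/and3P=> _ uc ec wc; have ac : next c w \in c by rewrite mem_next.
case: (rot_to ac) => i s rot_c.
have perm_c : perm_eq (next c w :: s) c by rewrite -rot_c perm_rot.
have := cycle_edge_next uc ec; rewrite -(rot_cycle i) rot_c /=.
rewrite rcons_path path_relI /= => /andP[/andP[e_s n_s] /andP[_ /eqP/next_inj lw]].
by exists s; split=> //; apply: lw.
Qed.

Lemma cycle_split c w z : graph_cycle c -> w \in c -> z \in c -> w != z ->
  exists A B, [/\ perm_eq (next c w :: A ++ next c z :: B) c,
    path e (next c w) A /\ last (next c w) A = z,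
    path e (next c z) B, path (frel (next c)) (next c z) B &
    last (next c z) B = w].
Proof.
move=> gc wc zc nwz; case: (cycle_open gc wc) => s [perm_s e_s n_s last_s].
have: z \in next c w :: s by rewrite (perm_mem perm_s).
move=> z_s; case/splitPl: z_s perm_s e_s n_s last_s => A B' lastA.
case: B' => [|b B] perm_s.
  by rewrite cats0 lastA => _ _ zw; rewrite zw eqxx in nwz.
rewrite !cat_path lastA /= last_cat /= => /and3P[eA _ eB] /and3P[_ /eqP nz nB] lB.
by subst b; exists A, B.
Qed.

Definition longest_cycle c := graph_cycle c /\
  forall c', graph_cycle c' -> size c' <= size c.

Definition detour c w z p :=
  [&& ~~ nilp p, uniq p, ~~ has (mem c) p & path e w (rcons p z)].

(** Paths and cycles share this form of connectedness.  The clause on the size of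
    the connecting path is what allows one vertex of a cycle to be skipped in
    exchange for a detour. *)
Definition joined (P : seq T) := forall x y a b, a \in P -> b \in P -> e x a -> e b y ->
  exists p, [/\ {subset p <= P}, uniq p, ~~ nilp p, path e x (rcons p y) &
    a != b -> 1 < size p].

Lemma path_joined h s : path e h s -> uniq (h :: s) -> joined (h :: s).
Proof.
have prefix a t b x y : path e a t -> uniq (a :: t) -> b \in a :: t ->
    e x a -> e b y ->
    exists p, [/\ {subset p <= a :: t}, uniq p, ~~ nilp p, path e x (rcons p y) &
      a != b -> 1 < size p].
  move=> et ut bt; case/splitPl: bt et ut => t1 t2 l1.
  rewrite cat_path -cat_cons cat_uniq => /andP[et1 _] /andP[ut1 _] xa by_.
  exists (a :: t1); split=> //.
  - by move=> u; rewrite mem_cat => ->.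
  - by rewrite /= xa rcons_path et1 l1.
  - by case: t1 l1 {et1 ut1} => //= ->; rewrite eqxx.
(* If [b] comes before [a], the connecting path is read backwards. *)
move=> es us x y a b a_s b_s xa by_.
case/splitPl: a_s es us b_s => s1 s2 l1; rewrite cat_path l1 => /andP[e1 e2] us b_s.
have sub2 : {subset a :: s2 <= h :: s1 ++ s2}.
  move=> u; rewrite -cat_cons mem_cat inE => /orP[/eqP->|->]; last by rewrite orbT.
  by rewrite -l1 mem_last.
have [b2|b2] := boolP (b \in a :: s2).
  have us2 : uniq (a :: s2).
    by move: us; rewrite -cat_cons lastI l1 cat_rcons cat_uniq => /and3P[].
  have [p [ps ? ? ? ?]] := prefix a s2 b x y e2 us2 b2 xa by_.
  by exists p; split=> // u /ps/sub2.
have b1 : b \in h :: s1.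
  move: b_s b2; rewrite -cat_cons mem_cat => /orP[//|bs2].
  by rewrite inE bs2 orbT.
have us1 : uniq (h :: s1) by move: us; rewrite -cat_cons cat_uniq => /andP[].
case/splitPl: b1 us1 l1 e1 {b2} us sub2 b_s => t1 t2 lb us1; rewrite last_cat lb => la.
rewrite cat_path lb => /andP[_ et2] us sub2 _.
have ut2 : uniq (b :: t2).
  by move: us1; rewrite -cat_cons lastI lb cat_rcons cat_uniq => /and3P[].
have at2 : a \in b :: t2 by rewrite -la mem_last.
rewrite esym in xa; rewrite esym in by_.
have [p [ps up p0 ep p2]] := prefix b t2 a y x et2 ut2 at2 by_ xa.
exists (rev p); split=> //.
- move=> u; rewrite mem_rev => /ps; rewrite inE -2!cat_cons 2!mem_cat.
  by case/orP=> [/eqP->|->]; rewrite ?orbT // -{1}lb mem_last.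
- by rewrite rev_uniq.
- by rewrite /nilp size_rev.
- by rewrite path_rev revK.
- by rewrite size_rev eq_sym.
Qed.

Lemma degree_split (A : {set T}) x :
  degree e x = #|[set y in A | e x y]| + #|[set y in ~: A | e x y]|.
Proof.
rewrite /degree -(cardsID A [set y | e x y]); congr (_ + _); apply: eq_card => y.
  by rewrite !inE andbC.
by rewrite !inE andbC.
Qed.

Lemma degree_non_neighbors x (X : {set T}) : (forall y, y \in X -> ~~ e x y) ->
  degree e x + #|X| <= #|T|.
Proof.
move=> nX; rewrite -(cardsC X) addnC leq_add2l subset_leq_card //.
by apply/subsetP => y; rewrite !inE; apply: contraTN => /nX.
Qed.

(** Ore's argument: if the predecessor of a neighbour of [h] were adjacent to the
    other end, exchanging one edge of the path would close it into a cycle. *)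
Lemma open_path_degree_sum h s : path e h s -> uniq (h :: s) -> 1 < size s ->
  ~~ closes_up (h :: s) ->
  #|[set x in h :: s | e h x]| + #|[set x in h :: s | e (last h s) x]| <= size s.
Proof.
move=> es us s2 open; set A := [set x in _ | e h x]; set D := [set x in _ | _].
pose f := prev (h :: s); have f_inj : injective f by apply: can_inj (next_prev us).
have disj : [disjoint f @: A & D].
  rewrite -setI_eq0; apply/eqP/setP => z; rewrite !inE; apply/negP.
  case/andP=> /imsetP[y]; rewrite !inE => /andP[ys hy] -> /andP[_ vy].
  case/negP: open; apply/closes_upP.
  have {}ys : y \in s by case/predU1P: ys hy => [->|//]; rewrite eirr.
  have [s1 [s3 def_s]] : exists s1 s3, s = s1 ++ y :: s3.
    by case/splitPr: ys => s1 s3; exists s1, s3.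
  have := cycle_next us; rewrite {2}def_s /= rcons_cat cat_path /= => /and3P[_ /eqP ny _].
  have fy : f y = last h s1 by apply: (next_inj us); rewrite next_prev.
  move: es us s2 vy; rewrite fy def_s cat_path last_cat /= => /and3P[e1 _ e3] us s2 vy.
  exists ((h :: s1) ++ rev (y :: s3)).
    rewrite /graph_cycle; apply/and3P; split.
    - by move: s2; rewrite !size_cat /= size_rev /=; clear; lia.
    - have /perm_uniq-> : perm_eq ((h :: s1) ++ rev (y :: s3)) ((h :: s1) ++ (y :: s3)).
        by rewrite perm_cat2l perm_rev.
      by [].
    - by rewrite /= rcons_cat cat_path e1 -path_rev /= hy rcons_path e3.
  by rewrite -cat_cons perm_cat2l perm_rev.
have sub : f @: A :|: D \subset [set x in h :: s] :\ last h s.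
  apply/subsetP => z; rewrite !inE => /orP[/imsetP[y]|/andP[zs vz]]; last first.
    by rewrite zs andbT; apply: contraTneq vz => ->; rewrite eirr.
  rewrite !inE => /andP[ys hy] ->; rewrite -in_cons mem_prev inE ys andbT.
  apply: contraTneq hy => fy; have := cycle_next us.
  rewrite /= rcons_path => /andP[_ /eqP last_h].
  by rewrite -[y](next_prev us) -/f fy last_h eirr.
have card_s : #|[set x in h :: s]| = (size s).+1 by rewrite cardsE (card_uniqP us).
have := subset_leq_card sub; rewrite cardsU (disjoint_setI0 disj) cards0 subn0.
rewrite card_imset // => /leq_trans-> //; rewrite -ltnS -card_s.
by rewrite [ltnRHS](cardsD1 (last h s)) inE mem_last.
Qed.

(** * Detours from a longest cycle *)

Section Longest.
Variable c : seq T.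
Hypothesis c_longest : longest_cycle c.
Let gc : graph_cycle c. Proof. by case: c_longest. Qed.
Let uc : uniq c. Proof. by case/and3P: gc. Qed.
Let c3 : 2 < size c. Proof. by case/and3P: gc. Qed.
Local Notation nx := (next c).

Lemma no_longer_cycle c' : uniq c' -> size c < size c' -> cycle e c' -> False.
Proof.
move=> uc' lt_c ec'; case: c_longest => _ /(_ c').
by rewrite /graph_cycle uc' ec' (ltn_trans c3 lt_c) leqNgt lt_c => /(_ isT).
Qed.

Lemma no_detour_next w p : w \in c -> ~~ detour c w (nx w) p.
Proof.
move=> wc; apply/negP; case/and4P=> p0 up pc ep.
case: (cycle_open gc wc) => s [perm_s e_s _ last_s].
apply: (@no_longer_cycle (nx w :: s ++ p)).
- by rewrite -cat_cons cat_uniq (perm_uniq perm_s) uc up andbT (eq_has (perm_mem perm_s)).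
- by rewrite -cat_cons size_cat (perm_size perm_s) -addn1 leq_add2l lt0n.
- by rewrite /= rcons_cat cat_path e_s last_s.
Qed.

(** The general exchange: [p] joins [w] to [z] and [q], possibly empty, joins
    their successors, so the cycle runs through all of [c], [p] and [q]. *)
Lemma no_parallel_detours w z p q : w \in c -> z \in c -> w != z ->
  detour c w z p -> uniq (p ++ q) -> ~~ has (mem c) q ->
  ~~ path e (nx w) (rcons q (nx z)).
Proof.
move=> wc zc wz /and4P[p0 up pc ep] upq qc; apply/negP => eq.
case: (cycle_split gc wc zc wz) => A [B [perm_AB [eA lA] eB _ lB]].
have perm_new : perm_eq (nx w :: q ++ (nx z) :: B ++ p ++ rev A) (c ++ p ++ q).
  exact: perm_cycle_of_detours.
rewrite -lA -{1}lB in ep; apply: (no_longer_cycle _ _ (cycle_of_detours eA eB eq ep)).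
- rewrite (perm_uniq perm_new) cat_uniq uc upq andbT has_cat.
  by rewrite negb_or pc qc.
- by rewrite (perm_size perm_new) !size_cat -addn1 leq_add2l addn_gt0 lt0n p0.
Qed.

Lemma detour_next w z p : w \in c -> z \in c -> detour c w z p -> ~~ e (nx w) (nx z).
Proof.
move=> wc zc wp; have [<-|wz] := eqVneq w z; first by rewrite eirr.
have := @no_parallel_detours w z p [::] wc zc wz wp.
by rewrite cats0 /= andbT; apply=> //; case/and4P: wp.
Qed.

(** The successor of [z] is dropped from the cycle; the detour makes up for it by
    its two vertices. *)
Lemma long_detour_next2 w z p : w \in c -> z \in c -> w != z -> 1 < size p ->
  detour c w z p -> ~~ e (nx w) (nx (nx z)).
Proof.
move=> wc zc wz p2 /and4P[p0 up pc ep]; apply/negP => euz.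
case: (cycle_split gc wc zc wz) => A [[|b B] [perm_AB [eA lA] eB nB lB]].
  (* Here [w] is the successor of [z], and the claim is irreflexivity. *)
  by rewrite -lB /= eirr in euz.
case/andP: nB => /= /eqP nb _; rewrite nb in euz; case/andP: eB => _ /= eB.
have perm_new : perm_eq (nx z :: nx w :: [::] ++ b :: B ++ p ++ rev A) (c ++ p).
  apply/permP => P; rewrite count_cat -(permP perm_AB).
  by rewrite /= !count_cat /= ?count_cat count_rev; clear; lia.
have u_new : uniq (nx z :: nx w :: [::] ++ b :: B ++ p ++ rev A).
  by rewrite (perm_uniq perm_new) cat_uniq uc up pc.
apply: (@no_longer_cycle (nx w :: [::] ++ b :: B ++ p ++ rev A)).
- by case/andP: u_new.
- by move: (perm_size perm_new) p2; rewrite /= !size_cat /=; clear; lia.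
- have lB1 : last b B = w by [].
  rewrite -lA -{1}lB1 in ep; apply: cycle_of_detours => //.
  by rewrite /= andbT.
Qed.

Definition attach P : {set T} := [set w in c | has (e w) P].

Lemma attach_detour P w z : joined P -> ~~ has (mem c) P ->
  w \in attach P -> z \in attach P -> exists p, detour c w z p.
Proof.
move=> jP Pc; rewrite !inE => /andP[_ /hasP[a aP wa]] /andP[_ /hasP[b bP zb]].
rewrite esym in zb; have [p [pP up p0 ep _]] := jP w z a b aP bP wa zb.
exists p; rewrite /detour p0 up ep andbT /=.
by apply: contra Pc => /hasP[x /pP xP xc]; apply/hasP; exists x.
Qed.

Lemma attach_long_detour P w z a b : joined P -> ~~ has (mem c) P ->
  w \in c -> z \in c -> w != z -> a \in P -> b \in P -> a != b ->
  e w a -> e z b -> ~~ e (nx w) (nx (nx z)).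
Proof.
move=> jP Pc wc zc wz aP bP ab wa; rewrite esym => bz.
have [p [pP up p0 ep p2]] := jP w z a b aP bP wa bz.
apply: (long_detour_next2 wc zc wz (p2 ab)); rewrite /detour p0 up ep andbT /=.
by apply: contra Pc => /hasP[x /pP xP xc]; apply/hasP; exists x.
Qed.

Lemma attach_next P w : joined P -> ~~ has (mem c) P ->
  w \in attach P -> ~~ has (e (nx w)) P.
Proof.
move=> jP Pc wP; have := wP; rewrite inE => /andP[wc _]; apply/negP => nP.
have nwP : nx w \in attach P by rewrite inE mem_next wc.
by have [p] := attach_detour jP Pc wP nwP; apply/negP/no_detour_next.
Qed.

Lemma attach_next_edge P w z : joined P -> ~~ has (mem c) P ->
  w \in attach P -> z \in attach P -> ~~ e (nx w) (nx z).
Proof.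
move=> jP Pc wP zP; have [p] := attach_detour jP Pc wP zP.
by move: wP zP; rewrite !inE => /andP[wc _] /andP[zc _]; apply: detour_next.
Qed.

Lemma attach_next_neq P w z : joined P -> ~~ has (mem c) P ->
  w \in attach P -> z \in attach P -> nx w != z.
Proof.
move=> jP Pc wP zP; apply: contraTneq (attach_next jP Pc wP) => ->.
by move: zP; rewrite inE negbK => /andP[].
Qed.

Lemma independent_successors P (W : {set T}) x : joined P -> ~~ has (mem c) P ->
  W \subset attach P -> x \in P -> independent e (x |: nx @: W).
Proof.
move=> jP Pc /subsetP sW xP.
have nx_x w : w \in W -> ~~ e (nx w) x.
  by move=> /sW/(attach_next jP Pc)/hasPn/(_ x xP).
apply/forall_inP => y /setU1P[->|/imsetP[w wW ->]];
  apply/forall_inP => z /setU1P[->|/imsetP[w' wW' ->]].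
- by rewrite eirr.
- by rewrite esym nx_x.
- exact: nx_x.
- by apply: attach_next_edge (sW _ wW) (sW _ wW').
Qed.

Hypothesis independent_small : forall I : {set T}, independent e I ->
  forall v, v \in I -> #|I| < degree e v.

Lemma successors_small P (W : {set T}) x : joined P -> ~~ has (mem c) P ->
  W \subset attach P -> x \in P ->
  #|W|.+1 < degree e x /\ (forall w, w \in W -> #|W|.+1 < degree e (nx w)).
Proof.
move=> jP Pc sW xP; have := independent_small (independent_successors jP Pc sW xP).
have x_succ : x \notin nx @: W.
  apply: contraNN Pc => /imsetP[w /(subsetP sW)]; rewrite inE => /andP[wc _] xw.
  by apply/hasP; exists x => //; rewrite xw /= mem_next.
rewrite cardsU1 x_succ (card_imset _ (next_inj uc)) add1n => lt_deg; split.
  exact: lt_deg (setU11 _ _).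
by move=> w wW; apply: lt_deg; apply: setU1r; apply: imset_f.
Qed.

(** The set [X], the successors of [W] and the second successors of the vertices of
    [B] other than [w] are disjoint sets of non-neighbours of [nx w].  The second
    successor of [w] itself follows [nx w] on the cycle, whence the correction. *)
Lemma successor_degree (w : T) (W B X : {set T}) : w \in W -> B \subset W ->
    (forall z, z \in W -> ~~ e (nx w) (nx z)) ->
    (forall z, z \in B -> z != w -> ~~ e (nx w) (nx (nx z))) ->
    (forall z z', z \in W -> z' \in W -> nx z != z') ->
    (forall x, x \in X ->
       [&& ~~ e (nx w) x, x \notin nx @: W & x \notin nx @: (nx @: W)]) ->
  degree e (nx w) + #|X| + #|W| + #|B| <= #|T| + (w \in B).
Proof.
move=> wW /subsetP sB nW nB gapW nX; have n_inj := next_inj uc.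
pose W1 := nx @: W; pose B2 := nx @: (nx @: (B :\ w)).
have cardW1 : #|W1| = #|W| by apply: card_imset.
have cardB2 : (w \in B) + #|B2| = #|B| by rewrite !card_imset // -cardsD1.
have disjWB : [disjoint W1 & B2].
  rewrite -setI_eq0; apply/eqP/setP => y; rewrite !inE; apply/negP.
  case/andP=> /imsetP[z zW ->] /imsetP[_ /imsetP[z' + ->]].
  rewrite !inE => /andP[_ /sB z'W] /n_inj zz'.
  by have := gapW z' z z'W zW; rewrite zz' eqxx.
have disjX : [disjoint X & W1 :|: B2].
  rewrite -setI_eq0; apply/eqP/setP => y; rewrite !inE; apply/negP.
  case/andP=> /nX/and3P[_ y1 y2]; rewrite (negPf y1) /= => /imsetP[z' + y_eq].
  case/imsetP=> z; rewrite !inE => /andP[_ /sB zW] z'z; case/negP: y2.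
  by rewrite y_eq z'z !imset_f.
have disjN : [disjoint [set y | e (nx w) y] & X :|: (W1 :|: B2)].
  rewrite -setI_eq0; apply/eqP/setP => y; rewrite !inE; apply/negP.
  case/andP=> wy /or3P[/nX/andP[]|/imsetP[z zW y_eq]|/imsetP[_ /imsetP[z + ->] y_eq]].
  - by rewrite wy.
  - by have := nW z zW; rewrite -y_eq wy.
  - by rewrite !inE => /andP[zw zB]; have := nB z zB zw; rewrite -y_eq wy.
have := max_card (mem ([set y | e (nx w) y] :|: (X :|: (W1 :|: B2)))).
rewrite cardsU (disjoint_setI0 disjN) cards0 subn0 -/(degree e (nx w)).
rewrite cardsU (disjoint_setI0 disjX) cards0 subn0.
rewrite cardsU (disjoint_setI0 disjWB) cards0 subn0 cardW1 -cardB2.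
by clear; lia.
Qed.

Hypothesis triple_sum : forall x y z, uniq [:: x; y; z] ->
  ~~ e x y -> ~~ e x z -> ~~ e y z ->
  #|T| <= degree e x + degree e y + degree e z.

Definition cycle_nbrs x : {set T} := [set z in c | e x z].

(** * A path outside the cycle that does not close up *)

Section OpenPath.
Variables (h : T) (s : seq T).
Local Notation P := (h :: s).
Local Notation v := (last h s).
Hypotheses (eP : path e h s) (uP : uniq P) (Pc : ~~ has (mem c) P).
Hypothesis P_maximal : forall x, x \notin c -> e h x || e v x -> x \in P.
Hypothesis P_open : ~~ closes_up P.

Definition ends_nbrs := cycle_nbrs h :|: cycle_nbrs v.
Local Notation W := ends_nbrs.
Definition common_nbrs := cycle_nbrs h :&: cycle_nbrs v.
Local Notation B := common_nbrs.

Let hP : h \in P. Proof. exact: mem_head. Qed.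
Let vP : v \in P. Proof. exact: mem_last. Qed.
Let jP : joined P. Proof. exact: path_joined. Qed.

Let notin_c x : x \in P -> x \notin c.
Proof. by move=> xP; apply: (hasPn Pc). Qed.

Let W_attach : W \subset attach P.
Proof.
apply/subsetP => w; rewrite !inE => /orP[] /andP[-> hw]; apply/hasP.
  by exists h; rewrite // esym.
by exists v; rewrite // esym.
Qed.

Let sBW : B \subset W.
Proof. by rewrite subIset // subsetUl. Qed.

Let W_c w : w \in W -> w \in c.
Proof. by rewrite !inE -andb_orr => /andP[]. Qed.

Lemma end_degrees : degree e h + degree e v <=
  #|[set x in P | e h x]| + #|[set x in P | e v x]| + (#|W| + #|B|).
Proof.
have end_degree x : (x == h) || (x == v) ->
    degree e x <= #|[set y in P | e x y]| + #|cycle_nbrs x|.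
  move=> xhv; rewrite (degree_split [set y in P]) leq_add //; apply: subset_leq_card.
    by apply/subsetP => y; rewrite !inE.
  apply/subsetP => y; rewrite !inE => /andP[yP xy]; rewrite xy andbT.
  apply: contraNT yP => yc; rewrite -in_cons P_maximal //.
  by case/orP: xhv xy => /eqP-> ->; rewrite ?orbT.
have := end_degree h; rewrite eqxx => /(_ isT).
have := end_degree v; rewrite eqxx orbT => /(_ isT).
rewrite cardsUI; clear; lia.
Qed.

(** The end [v] has more than [#|W| + 1] neighbours but at most [#|W|] on the
    cycle, so at least two of them lie on the path. *)
Lemma open_path_long : 1 < size s.
Proof.
have [+ _] := successors_small jP Pc W_attach vP.
rewrite (degree_split [set y in P]) => dv.
have le1 : #|[set y in ~: [set y in P] | e v y]| <= #|W|.
  apply: subset_leq_card; apply/subsetP => y; rewrite !inE => /andP[yP vy].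
  rewrite vy andbT; apply/orP; right; apply: contraNT yP => yc.
  by rewrite -in_cons P_maximal // vy orbT.
have le2 : #|[set y in [set y in P] | e v y]| <= size s.
  have card_P : #|[set x in P]| = (size s).+1 by rewrite cardsE (card_uniqP uP).
  rewrite -ltnS -card_P [ltnRHS](cardsD1 v) inE vP add1n ltnS.
  apply: subset_leq_card; apply/subsetP => y; rewrite !inE => /andP[-> vy].
  by rewrite andbT; apply: contraTneq vy => ->; rewrite eirr.
by move: dv le1 le2; clear; lia.
Qed.

Lemma ends_nonadjacent : ~~ e h v.
Proof.
apply: contra P_open => hv; apply/closes_upP; exists P => //.
by rewrite /graph_cycle uP !ltnS open_path_long /= rcons_path eP esym.
Qed.

Lemma ends_neq : h != v.
Proof.
case/lastP: s open_path_long uP => [//|s' x] _; rewrite last_rcons /=.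
by rewrite mem_rcons inE negb_or => /andP[/andP[]].
Qed.

Lemma end_degree_sum : degree e h + degree e v <= size s + (#|W| + #|B|).
Proof.
by apply: leq_trans end_degrees _; rewrite leq_add2r open_path_degree_sum // open_path_long.
Qed.

Let disjoint_P x : x \in c -> ~~ has (e x) P ->
  uniq [:: x; h; v] /\ ~~ e x h /\ ~~ e x v.
Proof.
move=> xc /hasPn xP; rewrite !xP // /= !inE ends_neq andbT negb_or.
have neq y : y \in P -> x != y.
  by apply: contraTneq => <-; apply/negP => /notin_c; rewrite xc.
by rewrite !neq.
Qed.

Let card_P : #|[set x in P]| = (size s).+1.
Proof. by rewrite cardsE (card_uniqP uP). Qed.

(** Otherwise the ends have so few neighbours that the degree sum attaches every
    vertex of the cycle to the path, although successors of attached vertices are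
    not attached. *)
Lemma ends_attached : W != set0.
Proof.
apply/negP => /eqP W0; have [x xc] : exists x, x \in c.
  by case: (c) c3 => // x c' _; exists x; rewrite mem_head.
have attached y : y \in c -> has (e y) P.
  move=> yc; apply/negPn/negP => yP; have [u3 [yh yv]] := disjoint_P yc yP.
  have := triple_sum u3 yh yv ends_nonadjacent.
  have := end_degree_sum; rewrite W0.
  have -> : B = set0 by apply/eqP; rewrite -subset0 -W0.
  have : degree e y + #|y |: [set x in P]| <= #|T|.
    apply: degree_non_neighbors => z; rewrite !inE => /predU1P[->|zP].
      by rewrite eirr.
    exact: (hasPn yP).
  rewrite cardsU1 inE card_P (contraL (@notin_c y)) //.
  by rewrite cards0; clear; lia.
have := attach_next jP Pc (w := x); rewrite inE xc attached // => /(_ isT).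
by rewrite attached // mem_next.
Qed.

(** The triple [nx w], [h], [v] has degree sum at most [#|T| - 1 - #|X|], plus one
    if [w] is adjacent to both ends, where [X] collects further non-neighbours of
    [nx w].  Vertices adjacent to both ends count twice in the degrees of the ends,
    but then also exclude their second successors. *)
Lemma successor_neighbors (w : T) (X : {set T}) : w \in W ->
  (forall x, x \in X -> [&& x \notin P, ~~ e (nx w) x, x \notin nx @: W &
     x \notin nx @: (nx @: W)]) -> #|X| < (w \in B).
Proof.
move=> wW nX; have wc := W_c wW.
have wP : w \in attach P by apply: (subsetP W_attach).
have nwP := attach_next jP Pc wP; have nwc : nx w \in c by rewrite mem_next.
have [u3 [nwh nwv]] := disjoint_P nwc nwP.
have := triple_sum u3 nwh nwv ends_nonadjacent; have := end_degree_sum.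
have disjX : [disjoint X & [set x in P]].
  rewrite -setI_eq0; apply/eqP/setP => x; rewrite !inE -in_cons; apply/negP.
  by case/andP=> /nX/and4P[/negP].
have := @successor_degree w W B (X :|: [set x in P]) wW.
rewrite cardsU (disjoint_setI0 disjX) cards0 subn0 card_P.
have nW z : z \in W -> ~~ e (nx w) (nx z).
  by move=> zW; apply: attach_next_edge jP Pc wP _; apply: (subsetP W_attach).
have nW' z z' : z \in W -> z' \in W -> nx z != z'.
  by move=> zW z'W; apply: attach_next_neq jP Pc _ _; apply: (subsetP W_attach).
have nB z : z \in B -> z != w -> ~~ e (nx w) (nx (nx z)).
  move=> zB zw; have [zc zh zv] : [/\ z \in c, e z h & e z v].
    by move: zB; rewrite !inE !(esym z) => /andP[/andP[? ?] /andP[_ ?]].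
  rewrite eq_sym in zw; move: wW; rewrite !inE wc /= => /orP[hw|vw].
    by apply: (attach_long_detour jP Pc wc zc zw hP vP ends_neq); rewrite // esym.
  by apply: (attach_long_detour jP Pc wc zc zw vP hP); rewrite // 1?eq_sym ?ends_neq // esym.
have nX' x : x \in X :|: [set x in P] ->
    [&& ~~ e (nx w) x, x \notin nx @: W & x \notin nx @: (nx @: W)].
  case/setUP=> [/nX/andP[_ //]|]; rewrite inE => xP; rewrite (hasPn nwP) //=.
  apply/andP; split; apply: contraNN (notin_c xP).
    by case/imsetP=> z /W_c zc ->; rewrite mem_next.
  by case/imsetP=> _ /imsetP[z /W_c zc ->] ->; rewrite !mem_next.
move=> /(_ sBW nW nB nW' nX'); clear; lia.
Qed.

(** The bound of [successor_neighbors] leaves no slack: it fails unless [w] is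
    adjacent to both ends, and it fails again as soon as its successor misses
    one vertex that it is allowed to see. *)
Lemma attached_to_both_ends w : w \in W -> [/\ w \in c, e w h & e w v].
Proof.
move=> wW; have := successor_neighbors (X := set0) wW.
rewrite cards0 lt0b => wB; have {wB} : w \in B by apply: wB => x; rewrite inE.
by rewrite !inE !(esym w) => /andP[/andP[-> ->] /andP[_ ->]].
Qed.

Lemma successor_adjacent w x : w \in W -> x \notin P ->
  x \notin nx @: W -> x \notin nx @: (nx @: W) -> e (nx w) x.
Proof.
move=> wW xP x1 x2; apply/negPn/negP => wx.
have := successor_neighbors (X := [set x]) wW; rewrite cards1 => lt1.
suff : 1 < (w \in B) by case: (w \in B).
by apply: lt1 => y; rewrite inE => /eqP->; rewrite xP wx x1.
Qed.

End OpenPath.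
End Longest.

(** Reversing the cycle transfers statements on successors to predecessors. *)
Lemma longest_cycle_rev c : longest_cycle c -> longest_cycle (rev c).
Proof.
case=> /and3P[c3 uc ec] cmax; split=> [|c' /cmax]; last by rewrite size_rev.
rewrite /graph_cycle size_rev c3 rev_uniq uc rev_cycle.
by rewrite (eq_cycle (e' := e)).
Qed.

Lemma cycle_minus c w : graph_cycle c -> w \in c -> exists s,
  [/\ perm_eq (w :: next c w :: s) c, path e (next c w) s & last (next c w) s = prev c w].
Proof.
move=> gc wc; have /and3P[c3 uc _] := gc.
have pc : prev c w \in c by rewrite mem_prev.
case: (cycle_open gc pc) => -[|b s]; rewrite next_prev // => -[perm_s].
  by rewrite -(perm_size perm_s) in c3.
by case/andP=> _ es /andP[/= /eqP nb _] ls; exists s; rewrite nb.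
Qed.

Lemma next_neq_prev c w : graph_cycle c -> w \in c -> next c w != prev c w.
Proof.
move=> gc wc; have [t [perm_t _ lt]] := cycle_minus gc wc.
have : uniq (w :: next c w :: t) by rewrite (perm_uniq perm_t); case/and3P: gc.
case: t lt perm_t => [_ /perm_size sz|x t /= <- _].
  by case/and3P: gc; rewrite -sz.
by case/and3P=> _ nxt _; apply: contraNneq nxt => ->; apply: mem_last.
Qed.

Lemma cycle_invariant c (S : {set T}) x : uniq c -> x \in c -> x \in S ->
  (forall y, y \in S -> prev c y \in S) -> {subset c <= S}.
Proof.
move=> uc xc xS step y yc.
have cyc : fcycle (next (rev c)) (rev c) by apply: cycle_next; rewrite rev_uniq.
have : fconnect (next (rev c)) x y by rewrite (fconnect_cycle cyc) ?mem_rev.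
move=> /iter_findex <-; elim: (findex _ x y) => //= n IH.
by rewrite next_rev // step.
Qed.

Section DegreeConditions.
Hypothesis independent_small : forall I : {set T}, independent e I ->
  forall v, v \in I -> #|I| < degree e v.
Hypothesis triple_sum : forall x y z, uniq [:: x; y; z] ->
  ~~ e x y -> ~~ e x z -> ~~ e y z ->
  #|T| <= degree e x + degree e y + degree e z.

Section OpenPathReversed.
Variable c : seq T.
Hypothesis c_longest : longest_cycle c.
Let gc : graph_cycle c. Proof. by case: c_longest. Qed.
Let uc : uniq c. Proof. by case/and3P: gc. Qed.
Let c3 : 2 < size c. Proof. by case/and3P: gc. Qed.
Local Notation nx := (next c).

Variables (h : T) (s : seq T).
Local Notation P := (h :: s).
Local Notation v := (last h s).
Hypotheses (eP : path e h s) (uP : uniq P) (Pc : ~~ has (mem c) P).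
Hypothesis P_maximal : forall x, x \notin c -> e h x || e v x -> x \in P.
Hypothesis P_open : ~~ closes_up P.
Local Notation W := (ends_nbrs c h s).
Let hP : h \in P. Proof. exact: mem_head. Qed.
Let vP : v \in P. Proof. exact: mem_last. Qed.
Let jP : joined P. Proof. exact: path_joined. Qed.
Let notin_c x : x \in P -> x \notin c.
Proof. by move=> xP; apply: (hasPn Pc). Qed.
Let both w : w \in W -> [/\ w \in c, e w h & e w v].
Proof. exact: (attached_to_both_ends c_longest). Qed.

Let W_sub : W \subset attach c P.
Proof.
apply/subsetP => w /both[wc wh _]; rewrite inE wc.
by apply/hasP; exists h.
Qed.

Lemma ends_nbrs_rev : ends_nbrs (rev c) h s = W.
Proof. by apply/setP => x; rewrite !inE !mem_rev. Qed.

Lemma predecessor_adjacent w x : w \in W -> x \notin P -> x \notin c -> e (prev c w) x.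
Proof.
move=> wW xP xc; rewrite -next_rev //.
have Pc' : ~~ has (mem (rev c)) P by rewrite (eq_has (mem_rev c)).
have P_maximal' y : y \notin rev c -> e h y || e v y -> y \in P.
  by rewrite mem_rev; apply: P_maximal.
apply: (successor_adjacent (longest_cycle_rev c_longest) _ _ eP uP Pc' P_maximal' P_open);
  rewrite ?ends_nbrs_rev //.
  by apply: contraNN xc => /imsetP[z /both[zc _ _] ->]; rewrite next_rev // mem_prev.
apply: contraNN xc => /imsetP[_ /imsetP[z /both[zc _ _] ->] ->].
by rewrite !next_rev // !mem_prev.
Qed.

(** A vertex [x] outside is adjacent to both cycle neighbours of some [w] in [W],
    hence not to [P].  By the bound on independent sets [x] has a neighbour [y]
    off the cycle, which is also outside [P], and replacing [w] by [y] and [x]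
    gives a longer cycle. *)
Lemma open_path_spans x : (x \in c) || (x \in P).
Proof.
apply/negPn/negP; rewrite negb_or => /andP[xc xP].
have [w wW] := set0Pn _ (ends_attached c_longest independent_small triple_sum
  eP uP Pc P_maximal P_open).
have [wc wh wv] := both wW.
have succ_adj y : y \notin P -> y \notin c -> e (nx w) y.
  move=> yP yc; apply: (successor_adjacent c_longest _ _ eP) => //.
    by apply: contraNN yc => /imsetP[z /both[zc _ _] ->]; rewrite mem_next.
  apply: contraNN yc => /imsetP[_ /imsetP[z /both[zc _ _] ->] ->].
  by rewrite !mem_next.
have x_P : ~~ has (e x) P.
  apply/negP => /hasP[y yP]; rewrite esym => yx.
  have [p [pP up p0 ep _]] := jP hP yP wh yx.
  have /negP[] := no_detour_next c_longest (rcons p x) wc.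
  rewrite /detour rcons_uniq up has_rcons negb_or /= xc rcons_path ep last_rcons.
  rewrite {1}/nilp size_rcons /= esym succ_adj // !andbT; apply/andP; split.
    by apply: contraNN xP => /pP.
  by apply: contraNN Pc => /hasP[z /pP zP zc]; apply/hasP; exists z.
have [y yc xy] : exists2 y, y \notin c & e x y.
  have jx : joined [:: x] by apply: (@path_joined x [::]).
  have xc' : ~~ has (mem c) [:: x] by rewrite /= orbF.
  have [+ _] := successors_small c_longest independent_small jx xc' (subxx _) (mem_head _ _).
  rewrite ltnNge => /negP small; have [y yP | none] := pickP [pred y | (y \notin c) && e x y].
    by case/andP: yP => yc xy; exists y.
  case: small; apply: leqW; apply: subset_leq_card; apply/subsetP => y.
  rewrite !inE /= orbF esym => yx; rewrite yx andbT.
  by have /= := none y; rewrite esym yx andbT => /negbFE.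
have yP : y \notin P by apply: contraNN x_P => yP; apply/hasP; exists y.
have [t [perm_t et lt]] := cycle_minus gc wc.
have : uniq (w :: nx w :: t) by rewrite (perm_uniq perm_t).
case/andP=> wt ut.
apply: (no_longer_cycle c_longest (c' := nx w :: t ++ [:: y; x])).
- have tc z : z \in nx w :: t -> z \in c.
    by move=> zt; rewrite -(perm_mem perm_t) inE zt orbT.
  rewrite -cat_cons cat_uniq; apply/and3P; split=> //.
    by apply/hasPn => z; rewrite !inE => /orP[]/eqP->; apply/negP => /tc; apply/negP.
  by rewrite /= inE andbT; apply: contraTneq xy => ->; rewrite eirr.
- by rewrite -(perm_size perm_t) /= size_cat addn2.
- rewrite /= rcons_cat cat_path et lt /= esym in xy *.
  by rewrite predecessor_adjacent // xy esym succ_adj.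
Qed.

Lemma open_path_two_cycles : two_cycles.
Proof.
have spans := open_path_spans.
have [w0 w0W] := set0Pn _ (ends_attached c_longest independent_small triple_sum
  eP uP Pc P_maximal P_open).
have nx_P w : w \in W -> ~~ has (e (nx w)) P.
  by move=> wW; apply: (attach_next c_longest jP Pc); apply: (subsetP W_sub).
have [_ nx_degree] := successors_small c_longest independent_small jP Pc W_sub hP.
have nx_nx w z : w \in W -> z \in W -> z != w -> ~~ e (nx w) (nx (nx z)).
  move=> wW zW zw; have [wc wh wv] := both wW; have [zc zh zv] := both zW.
  rewrite eq_sym in zw; apply: (attach_long_detour c_longest jP Pc wc zc zw hP vP) => //.
  exact: (ends_neq c_longest _ eP uP Pc P_maximal).
have [w /andP[wW wpw] | no_shortcut] := pickP [pred w in W | e (nx w) (prev c w)].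
  have [wc wh wv] := both wW; have [t [perm_t et lt]] := cycle_minus gc wc.
  have : uniq (w :: nx w :: t) by rewrite (perm_uniq perm_t).
  rewrite cons_uniq => /andP[wt ut].
  have t2 : 1 < size t.
    have := nx_degree w wW; have : 0 < #|W| by apply/card_gt0P; exists w.
    suff : degree e (nx w) <= (size t).+1 by clear; lia.
    apply: leq_trans (card_size (w :: t)); apply: subset_leq_card.
    apply/subsetP => x; rewrite inE => wx.
    have xP : x \notin P by apply: contraTN wx; apply/hasPn/nx_P.
    have := spans x; rewrite (negPf xP) orbF -(perm_mem perm_t) !inE.
    by case/or3P=> [->//|/eqP xw|->]; rewrite ?orbT //; rewrite xw eirr in wx.
  have wP : w \notin P by apply: contraTN wc; apply: notin_c.
  have tc z : z \in nx w :: t -> z \in c.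
    by move=> zt; rewrite -(perm_mem perm_t) inE zt orbT.
  exists (nx w :: t), (w :: P); split.
  - by rewrite /graph_cycle /= !ltnS t2 -cons_uniq ut rcons_path et lt esym.
  - rewrite /graph_cycle cons_uniq wP uP /= rcons_path wh eP esym wv !andbT.
    have := open_path_long c_longest independent_small eP uP Pc P_maximal.
    by case: (s).
  - rewrite cat_uniq ut cons_uniq wP uP !andbT; apply/hasPn => z; rewrite in_cons.
    by case/predU1P=> [->|/notin_c]; last by apply: contraNN => /tc.
  - move=> x; rewrite mem_cat [x \in w :: _]in_cons orbCA orbA.
    by rewrite -in_cons (perm_mem perm_t) spans.
(* The predecessor of [w] is not adjacent to its successor, so it is one of the
   exceptions in [successor_adjacent]. *)
have three_back w : w \in W -> exists2 z, z \in W & prev c w = nx (nx z).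
  move=> wW; have [wc wh wv] := both wW.
  have pP : prev c w \notin P by apply: contraTN wc => /notin_c; rewrite mem_prev.
  have [/imsetP[z zW pz]|p1] := boolP (prev c w \in nx @: W).
    have [zw|zw] := eqVneq z w; first by have := next_neq_prev gc wc; rewrite pz zw eqxx.
    have := nx_nx w z wW zW zw; rewrite -pz next_prev //.
    by rewrite esym next_cycle //; case/and3P: gc.
  have [/imsetP[_ /imsetP[z zW ->] pz]|p2] := boolP (prev c w \in nx @: (nx @: W)).
    by exists z.
  have := no_shortcut w; rewrite /= wW /=.
  by rewrite (successor_adjacent c_longest _ _ eP).
pose S := W :|: nx @: W :|: nx @: (nx @: W).
have cS : {subset c <= S}.
  have [w0c _ _] := both w0W.
  apply: (cycle_invariant uc w0c); first by rewrite /S -setUA; apply/setUP; left.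
  move=> y /setUP[/setUP[yW|/imsetP[z zW ->]]|/imsetP[_ /imsetP[z zW ->] ->]].
  - have [z zW ->] := three_back y yW; apply/setUP; right.
    by do 2 apply: imset_f.
  - by rewrite prev_next // /S -setUA; apply/setUP; left.
  - rewrite prev_next //; apply/setUP; left; apply/setUP; right; exact: imset_f.
have := nx_degree w0 w0W; rewrite ltnNge => /negP[].
apply: (@leq_trans #|nx (nx w0) |: W|); last by rewrite cardsU1 -add1n leq_add2r leq_b1.
apply: subset_leq_card; apply/subsetP => x; rewrite [x \in finset _]inE => wx.
have xP : x \notin P by apply: contraTN wx; apply/hasPn/nx_P.
have xc : x \in c by have := spans x; rewrite (negPf xP) orbF.
case/setUP: (cS x xc) => [/setUP[|/imsetP[z zW xz]]|/imsetP[_ /imsetP[z zW ->] xz]].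
- exact: setU1r.
- have := attach_next_edge c_longest jP Pc (subsetP W_sub _ w0W) (subsetP W_sub _ zW).
  by rewrite -xz wx.
- have [zw|zw] := eqVneq z w0; first by rewrite xz zw setU11.
  by have := nx_nx w0 z w0W zW zw; rewrite -xz wx.
Qed.
End OpenPathReversed.

(** * Cycles that are components of the rest of the graph *)

Definition cycle_component c D := [/\ graph_cycle D, ~~ has (mem c) D &
  forall x y, x \in D -> y \notin c -> e x y -> y \in D].

Lemma joined_cycle D : graph_cycle D -> joined D.
Proof.
case: D => [//|h s] /and3P[_ us]; rewrite /= rcons_path => /andP[es _].
exact: path_joined.
Qed.

Lemma component_degree c D x : cycle_component c D -> x \in D ->
  degree e x < size D + #|[set z in c | e x z]|.
Proof.
case=> /and3P[_ uD _] _ closed xD.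
have <- : #|[set y in D]| = size D by rewrite cardsE (card_uniqP uD).
rewrite (cardsD1 x [set y in D]) inE xD add1n addSn ltnS (degree_split [set z in c]).
rewrite addnC leq_add //; apply: subset_leq_card; apply/subsetP => y; rewrite !inE //.
case/andP=> yc xy; rewrite (closed x) // andbT.
by apply: contraTneq xy => ->; rewrite eirr.
Qed.

Section TwoComponents.
Variable c : seq T.
Hypothesis c_longest : longest_cycle c.
Let gc : graph_cycle c. Proof. by case: c_longest. Qed.
Let uc : uniq c. Proof. by case/and3P: gc. Qed.
Local Notation nx := (next c).

Lemma component_separated D1 D2 x y : cycle_component c D1 -> cycle_component c D2 ->
  ~~ has (mem D1) D2 -> x \in D1 -> y \in D2 -> ~~ e x y /\ x != y.
Proof.
case=> _ _ closed [_ D2c _] D12 xD yD; have yD1 := hasPn D12 y yD.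
split; last by apply: contraNneq yD1 => <-.
by apply: contraNN yD1 => xy; apply: (closed x) => //; apply: (hasPn D2c).
Qed.

Lemma card_components D1 D2 : cycle_component c D1 -> cycle_component c D2 ->
  ~~ has (mem D1) D2 -> #|[set x in D1 ++ D2]| = size D1 + size D2.
Proof.
move=> [/and3P[_ u1 _] _ _] [/and3P[_ u2 _] _ _] D12.
by rewrite cardsE -size_cat; apply/card_uniqP; rewrite cat_uniq u1 u2 andbT.
Qed.

(** The degree sum of [nx w], a vertex [y] of [D1] and a vertex of [D2] is at most
    [#|T| - 1 + #|attach c D2| - #|attach c D1|]: the neighbours of [y] on the
    cycle are compensated by their second successors, which [nx w] misses.  For
    this [y] has to differ from a neighbour of [w] in [D1]. *)
Lemma fewer_attachments D1 D2 w : cycle_component c D1 -> cycle_component c D2 ->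
  ~~ has (mem D1) D2 -> w \in attach c D1 -> nx w \notin attach c D2 ->
  #|attach c D1| < #|attach c D2|.
Proof.
move=> comp1 comp2 D12 wD1 nwD2.
have [gD1 D1c closed1] := comp1; have [gD2 D2c closed2] := comp2.
have j1 := joined_cycle gD1; have nw1 := attach_next c_longest j1 D1c wD1.
have [wc /hasP[y1 y1D wy1]] : w \in c /\ has (e w) D1 by apply/andP; rewrite inE in wD1.
have nwc : nx w \in c by rewrite mem_next.
have nw2 : ~~ has (e (nx w)) D2 by move: nwD2; rewrite inE nwc.
pose y := next D1 y1; have yD : y \in D1 by rewrite mem_next.
have y1y : y1 != y.
  have /and3P[_ _ eD1] := gD1.
  by apply: contraTneq (next_cycle eD1 y1D); rewrite -/y => <-; rewrite eirr.
have [r rD] : exists r, r \in D2.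
  by case: (D2) gD2 => // r D _; exists r; rewrite mem_head.
have [yr y_neq_r] := component_separated comp1 comp2 D12 yD rD.
pose B := [set z in c | e y z].
have B_sub : B \subset attach c D1.
  apply/subsetP => z; rewrite !inE => /andP[-> yz].
  by apply/hasP; exists y; rewrite // esym.
have off x : x \in D1 \/ x \in D2 -> x \notin c.
  by case=> xD; [apply: (hasPn D1c) | apply: (hasPn D2c)].
have := @successor_degree c c_longest w (attach c D1) B [set x in D1 ++ D2] wD1 B_sub.
rewrite (card_components comp1 comp2) // => /(_ _ _ _ _) bound.
have {}bound : degree e (nx w) + (size D1 + size D2) + #|attach c D1| + #|B| <=
    #|T| + (w \in B).
  apply: bound.
  - by move=> z zD1; apply: (attach_next_edge c_longest j1 D1c).
  - move=> z; rewrite inE => /andP[zc yz] zw; rewrite eq_sym in zw.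
    by apply: (attach_long_detour c_longest j1 D1c wc zc zw y1D yD); rewrite // esym.
  - by move=> z z' zD z'D; apply: (attach_next_neq c_longest j1 D1c).
  - move=> x; rewrite inE mem_cat => /orP xD; have xc := off x xD; apply/and3P; split.
    + by case: xD => xD; [apply: (hasPn nw1) | apply: (hasPn nw2)].
    + apply: contraNN xc => /imsetP[z]; rewrite inE => /andP[zc _] ->.
      by rewrite mem_next.
    + apply: contraNN xc => /imsetP[_ /imsetP[z + ->] ->].
      by rewrite inE !mem_next => /andP[].
have deg_y := component_degree comp1 yD; have deg_r := component_degree comp2 rD.
have r_att : #|[set z in c | e r z]| <= #|attach c D2|.
  apply: subset_leq_card; apply/subsetP => z; rewrite !inE => /andP[-> rz].
  by apply/hasP; exists r; rewrite // esym.
have neqD x : x \in D1 \/ x \in D2 -> nx w != x.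
  by move/off; apply: contraNneq => <-.
have u3 : uniq [:: nx w; y; r].
  by rewrite /= !inE negb_or y_neq_r !neqD; [ | right | left].
have := triple_sum u3 (hasPn nw1 y yD) (hasPn nw2 r rD) yr.
by move: bound deg_y deg_r r_att; rewrite -/B; case: (w \in B); clear; lia.
Qed.

Lemma no_two_components D1 D2 : cycle_component c D1 -> cycle_component c D2 ->
  ~~ has (mem D1) D2 -> False.
Proof.
move=> comp1 comp2 D12; have D21 : ~~ has (mem D2) D1 by rewrite has_sym.
have [gD1 D1c closed1] := comp1; have [gD2 D2c closed2] := comp2.
pose N1 := attach c D1; pose N2 := attach c D2.
have card_succ (A : {set T}) : #|nx @: A| = #|A| by rewrite card_imset //; apply: next_inj.
have [sub12|/subsetPn[_ /imsetP[w wN1 ->] nwN2]] := boolP (nx @: N1 \subset N2); last first.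
  have lt12 := fewer_attachments comp1 comp2 D12 wN1 nwN2.
  have [sub21|/subsetPn[_ /imsetP[w' wN2 ->] nwN1]] := boolP (nx @: N2 \subset N1).
    by have := subset_leq_card sub21; rewrite card_succ leqNgt lt12.
  by have := fewer_attachments comp2 comp1 D21 wN2 nwN1; rewrite ltnNge ltnW.
have [sub21|/subsetPn[_ /imsetP[w' wN2 ->] nwN1]] := boolP (nx @: N2 \subset N1); last first.
  have := fewer_attachments comp2 comp1 D21 wN2 nwN1.
  by rewrite ltnNge -(card_succ N1) subset_leq_card.
have in12 w : w \in N1 -> nx w \in N2 by move=> wN; apply: (subsetP sub12); apply: imset_f.
have in21 w : w \in N2 -> nx w \in N1 by move=> wN; apply: (subsetP sub21); apply: imset_f.
have j1 := joined_cycle gD1; have j2 := joined_cycle gD2.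
have [N1_0|[w wN1]] := set_0Vmem N1; last first.
  (* Then [w] and its second successor are attached to [D1], their successors to
     [D2], and the two detours combine into a longer cycle. *)
  have w1N2 := in12 w wN1; have w2N1 := in21 _ w1N2; have w3N2 := in12 _ w2N1.
  have [wc /hasP[a aD wa]] : w \in c /\ has (e w) D1 by apply/andP; rewrite inE in wN1.
  have [w2c /hasP[b bD wb]] : nx (nx w) \in c /\ has (e (nx (nx w))) D1.
    by apply/andP; rewrite inE in w2N1.
  have /hasP[a' a'D wa'] : has (e (nx w)) D2 by move: w1N2; rewrite inE => /andP[].
  have /hasP[b' b'D wb'] : has (e (nx (nx (nx w)))) D2 by move: w3N2; rewrite inE => /andP[].
  rewrite esym in wb; rewrite esym in wb'.
  have [p [pD up p0 ep _]] := j1 _ _ _ _ aD bD wa wb.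
  have [q [qD uq _ eq _]] := j2 _ _ _ _ a'D b'D wa' wb'.
  have ww2 : w != nx (nx w).
    by apply: contra (next_neq_prev gc wc) => /eqP {2}->; rewrite prev_next.
  have pc : ~~ has (mem c) p by apply/hasPn => x /pD; apply: (hasPn D1c).
  have qc : ~~ has (mem c) q by apply/hasPn => x /qD; apply: (hasPn D2c).
  have dp : detour c w (nx (nx w)) p by rewrite /detour p0 up pc.
  have upq : uniq (p ++ q).
    rewrite cat_uniq up uq andbT; apply/hasPn => x /qD xD2.
    by apply: contra (hasPn D12 x xD2) => /pD.
  by case/negP: (no_parallel_detours c_longest wc w2c ww2 dp upq qc).
(* With no edges between [c], [D1] and [D2], three vertices chosen one on each
   have a small degree sum. *)
have N2_0 : N2 = set0.
  by have [//|[w /in21]] := set_0Vmem N2; rewrite N1_0 inE.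
have no_att x D : cycle_component c D -> attach c D = set0 -> x \in c -> ~~ has (e x) D.
  by move=> _ D0 xc; have := in_set0 x; rewrite -D0 inE xc => /= ->.
have [w wc] : exists w, w \in c.
  by case: (c) gc => // w c' _; exists w; rewrite mem_head.
have [y yD] : exists y, y \in D1.
  by case: (D1) gD1 => // y D _; exists y; rewrite mem_head.
have [r rD] : exists r, r \in D2.
  by case: (D2) gD2 => // r D _; exists r; rewrite mem_head.
have [yr y_neq_r] := component_separated comp1 comp2 D12 yD rD.
have deg_y := component_degree comp1 yD; have deg_r := component_degree comp2 rD.
have no_c D x : cycle_component c D -> attach c D = set0 -> x \in D -> [set z in c | e x z] = set0.
  move=> compD D0 xD; apply/setP => z; rewrite !inE; apply/negP => /andP[zc xz].
  by case/negP: (hasPn (no_att z D compD D0 zc) x xD); rewrite esym.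
rewrite (no_c _ _ comp1 N1_0 yD) cards0 addn0 in deg_y.
rewrite (no_c _ _ comp2 N2_0 rD) cards0 addn0 in deg_r.
have w1 := no_att w D1 comp1 N1_0 wc; have w2 := no_att w D2 comp2 N2_0 wc.
have neqD x : (x \in D1) || (x \in D2) -> w != x.
  case/orP=> xD; apply: contraTneq wc => ->; first exact: (hasPn D1c).
  exact: (hasPn D2c).
have u3 : uniq [:: w; y; r].
  by rewrite /= !inE negb_or y_neq_r !neqD ?yD ?rD ?orbT.
have := triple_sum u3 (hasPn w1 y yD) (hasPn w2 r rD) yr.
have : degree e w + #|w |: [set x in D1 ++ D2]| <= #|T|.
  apply: degree_non_neighbors => x; rewrite !inE => /predU1P[->|].
    by rewrite eirr.
  by rewrite mem_cat => /orP[/(hasPn w1)|/(hasPn w2)].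
rewrite cardsU1 (card_components comp1 comp2) // inE mem_cat.
rewrite (contraTN (@neqD w)) ?eqxx //.
by move: deg_y deg_r; clear; lia.
Qed.

End TwoComponents.

(** * Longest paths and the covering by cycles *)

Lemma longest_path_in (S : pred T) x : S x -> exists h s,
  [/\ path e h s, uniq (h :: s), {subset h :: s <= S} &
   forall h' s', path e h' s' -> uniq (h' :: s') -> {subset h' :: s' <= S} ->
     size s' <= size s].
Proof.
move=> Sx; pose Q p := [&& sorted e p, uniq p & all S p].
have Qx : Q [:: x] by rewrite /Q /= Sx.
have [|[|h s] /and3P[es us /allP sS] max_s] := longest_seq Qx.
- by move=> s /and3P[].
- by have := max_s _ Qx.
exists h, s; split=> // h' s' es' us' sS'.
by apply: (max_s (h' :: s')); apply/and3P; split=> //; apply/allP.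
Qed.

Section LongestPath.
Variables (S : pred T) (h : T) (s : seq T).
Hypotheses (es : path e h s) (us : uniq (h :: s)) (sS : {subset h :: s <= S}).
Hypothesis s_max : forall h' s', path e h' s' -> uniq (h' :: s') ->
  {subset h' :: s' <= S} -> size s' <= size s.

Lemma longest_path_ends x : S x -> e h x || e (last h s) x -> x \in h :: s.
Proof.
move=> Sx hx; apply/negPn/negP => xs; case/orP: hx => [hx|vx].
  suff : size (h :: s) <= size s by rewrite ltnn.
  apply: (s_max (h' := x)); first by rewrite /= esym hx.
    by rewrite cons_uniq xs.
  by move=> y /predU1P[->|/sS].
suff : size (rcons s x) <= size s by rewrite size_rcons ltnn.
apply: (s_max (h' := h)); rewrite ?rcons_path ?es //.
  by rewrite -rcons_cons rcons_uniq xs.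
by move=> y; rewrite -rcons_cons mem_rcons => /predU1P[->|/sS].
Qed.

(** Opened next to any of its vertices, the cycle is again a longest path, so every
    vertex of it behaves like an end. *)
Lemma longest_path_closed D x y : graph_cycle D -> perm_eq D (h :: s) ->
  x \in D -> S y -> e x y -> y \in D.
Proof.
move=> gD Ds xD Sy xy; apply/negPn/negP => yD.
have [w wD nx_w] : exists2 w, w \in D & next D w = x.
  by exists (prev D x); rewrite ?mem_prev ?next_prev //; case/and3P: gD.
have [t [perm_t et _ _]] := cycle_open gD wD; rewrite nx_w in perm_t et.
have xt_s := perm_trans perm_t Ds.
suff : size (x :: t) <= size s by rewrite (perm_size xt_s) ltnn.
apply: (s_max (h' := y)); first by rewrite /= esym xy.
  by rewrite cons_uniq (perm_uniq xt_s) us (perm_mem perm_t) yD.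
move=> z; rewrite in_cons => /predU1P[->//|]; rewrite (perm_mem xt_s).
exact: sS.
Qed.

End LongestPath.

Lemma min_degree x : 1 < degree e x.
Proof.
rewrite -(cards1 x); apply: independent_small (set11 x).
by apply/forall_inP => y /set1P->; apply/forall_inP => z /set1P->; rewrite eirr.
Qed.

(** The first vertex of a longest path has a second neighbour on that path. *)
Lemma exists_cycle (x : T) : exists c, graph_cycle c.
Proof.
have [h [s [es us sS s_max]]] := @longest_path_in predT x isT.
have hs y : e h y -> y \in s.
  move=> hy; have := longest_path_ends es us sS s_max (x := y) isT.
  by rewrite hy inE => /(_ isT)/predU1P[yh|//]; rewrite yh eirr in hy.
have : 0 < #|[set y | e h y] :\ head h s|.
  have := min_degree h; rewrite /degree (cardsD1 (head h s)).
  by case: (_ \in _) => //; clear; lia.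
case/card_gt0P=> y; rewrite !inE => /andP[y_head hy].
case/splitPr: (hs y hy) y_head es us => -[|a p1] p2 /=; first by rewrite eqxx.
rewrite cat_path -cat_cons => _ /and3P[ha e1 /andP[ly _]] us.
exists (h :: a :: rcons p1 y); rewrite /graph_cycle /= size_rcons /= !rcons_path last_rcons.
rewrite ha e1 ly esym hy !andbT.
have : uniq ((h :: a :: rcons p1 y) ++ p2) by rewrite /= cat_rcons.
by rewrite cat_uniq => /andP[].
Qed.

Lemma two_cycles_exist (x0 : T) : two_cycles.
Proof.
have [c0 gc0] := exists_cycle x0.
have [c gc c_max] := longest_seq gc0 (fun c gc => let: And3 _ uc _ := and3P gc in uc).
have c_longest : longest_cycle c by [].
have uc : uniq c by case/and3P: gc.
have [c_all|] := boolP [forall x, x \in c].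
  by exists c, [::]; rewrite cats0 orbT; split=> // x; apply/forallP.
rewrite negb_forall => /existsP[x1 x1c].
have [h [s [es us sS s_max]]] := @longest_path_in [pred x | x \notin c] x1 x1c.
have sc : ~~ has (mem c) (h :: s) by apply/hasPn => x /sS.
have s_ends x : x \notin c -> e h x || e (last h s) x -> x \in h :: s.
  exact: (longest_path_ends es us sS s_max).
have [/closes_upP[D1 gD1 D1s]|] := boolP (closes_up (h :: s)); last first.
  exact: (open_path_two_cycles c_longest es us sc s_ends).
have comp1 : cycle_component c D1.
  split=> // [|x y xD yc xy]; first by rewrite (eq_has_r (perm_mem D1s)).
  exact: (longest_path_closed us sS s_max gD1 D1s xD yc xy).
have [all1|] := boolP [forall x, x \in c ++ D1].
  exists c, D1; rewrite gD1; split=> // [|x]; last exact/forallP.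
  by rewrite cat_uniq uc; case: comp1 => /and3P[_ -> _] ->.
rewrite negb_forall => /existsP[x2]; rewrite mem_cat negb_or => x2c.
pose S := [pred x | (x \notin c) && (x \notin D1)].
have [h2 [s2 [es2 us2 sS2 s2_max]]] := @longest_path_in S x2 x2c.
have s2c : ~~ has (mem c) (h2 :: s2) by apply/hasPn => x /sS2/andP[].
have s2_off x y : x \in h2 :: s2 -> y \notin c -> e x y -> S y.
  case: comp1 => _ _ closed1 /sS2/andP[xc xD1] yc xy; rewrite /S /= yc /=.
  by apply: contra xD1 => yD1; apply: (closed1 y) => //; rewrite esym.
have s2_ends x : x \notin c -> e h2 x || e (last h2 s2) x -> x \in h2 :: s2.
  move=> xc hx; apply: (longest_path_ends es2 us2 sS2 s2_max) => //.
  by case/orP: hx; apply: s2_off => //; rewrite ?mem_head ?mem_last.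
have [/closes_upP[D2 gD2 D2s]|] := boolP (closes_up (h2 :: s2)); last first.
  exact: (open_path_two_cycles c_longest es2 us2 s2c s2_ends).
have comp2 : cycle_component c D2.
  split=> // [|x y xD yc xy]; first by rewrite (eq_has_r (perm_mem D2s)).
  apply: (longest_path_closed us2 sS2 s2_max gD2 D2s xD) => //.
  by apply: s2_off yc xy; rewrite -(perm_mem D2s).
case: (no_two_components c_longest comp1 comp2).
by apply/hasPn => x; rewrite (perm_mem D2s) => /sS2/andP[].
Qed.

End DegreeConditions.


(** * From two cycles to a 2-factor *)

Lemma next_id c x : x \notin c -> next c x = x.
Proof. by rewrite next_nth => /negPf->. Qed.

(** Since [next] fixes the vertices off its cycle, composing the two successor
    functions gives a permutation of all vertices whose orbits are the cycles. *)
Lemma two_cycles_two_factor : two_cycles ->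
  exists f : rel T, two_factor e f /\ num_cycles f <= 2.
Proof.
case=> c1 [c2 [g1 g2 u12 all12]]; pose succ x := next c2 (next c1 x).
have [u1 c12 u2] := and3P (eq_ind _ is_true u12 _ (cat_uniq c1 c2)).
have succ_inj : injective succ by apply: inj_comp; apply: next_inj.
have succ1 x : x \in c1 -> succ x = next c1 x.
  move=> x1; rewrite /succ [LHS]next_id //.
  by apply/negP => /(hasPn c12) /=; rewrite mem_next x1.
have succ2 x : x \in c2 -> succ x = next c2 x.
  by move=> x2; rewrite /succ (next_id (hasPn c12 x x2)).
have on_cycle x : exists c, [/\ graph_cycle c, x \in c & {in c, succ =1 next c}].
  have := all12 x; rewrite mem_cat => /orP[x1|x2]; first by exists c1.
  exists c2; split=> //; case/orP: g2 => // /nilP c2_nil.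
  by rewrite c2_nil in x2.
pose f x y := (y == succ x) || (x == succ y).
have f_sym : symmetric f by move=> x y; rewrite /f orbC.
have e_succ x : e x (succ x).
  have [c [/and3P[_ _ ec] xc sc]] := on_cycle x.
  by rewrite sc // next_cycle.
have f_e : subrel f e by move=> x y /orP[]/eqP->; last rewrite esym.
have f_degree x : degree f x = 2.
  have [c [gc xc sc]] := on_cycle x; have uc : uniq c by case/and3P: gc.
  have := next_neq_prev gc xc; set y := next c x; set z := prev c x => yz.
  rewrite -(eqP (_ : #|[set y; z]| == 2)); last by rewrite cards2 yz.
  apply: eq_card => w; rewrite !inE /f sc //; congr (_ || _).
  have sz : succ z = x by rewrite sc ?mem_prev // /z next_prev.
  by rewrite eq_sym -[RHS](inj_eq succ_inj) sz.
have cycle_connect c x y : uniq c -> {in c, succ =1 next c} -> x \in c -> y \in c ->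
    connect f x y.
  move=> uc sc xc yc; have : fconnect (next c) x y.
    by rewrite (fconnect_cycle (cycle_next uc)).
  apply: connect_sub => a b /eqP <-; have [ac|ac] := boolP (a \in c).
    by apply: connect1; rewrite /f sc // eqxx.
  by rewrite next_id.
have f_conn := sym_connect_sym f_sym.
exists f; split.
  split=> //; split=> // x; rewrite /f orbb.
  by apply: contraTF (e_succ x) => /eqP<-; rewrite eirr.
have [x1 x1c] : exists x1, x1 \in c1.
  by case: (c1) g1 => // x1 ? _; exists x1; rewrite mem_head.
have [x2 x2c] : exists x2, {in c2, forall y, connect f x2 y}.
  case: (c2) u2 succ2 => [|x2 d] u2' succ2'; first by exists x1.
  by exists x2 => y yd; apply: (cycle_connect (x2 :: d)); rewrite ?mem_head.
apply: leq_trans (_ : #|[set root f x1; root f x2]| <= 2); last first.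
  by rewrite cards2; case: (_ != _).
apply: subset_leq_card; apply/subsetP => x; rewrite !inE andbT => /eqP <-.
have := all12 x; rewrite mem_cat => /orP[xc|xc]; apply/orP; [left|right];
  apply/eqP/(rootP f_conn); rewrite f_conn.
  exact: (cycle_connect c1).
exact: x2c.
Qed.

End Cycles.

Theorem corollary10 (T : finType) (e : rel T) (n : nat)
    (He : simple_graph e) (Hn : #|T| = n)
    (Hsigma : leq_inf n (sigma3 e))
    (Hdelta : forall I : {set T}, I != set0 -> independent e I ->
       #|I| <= delta e I - 1) :
  exists f : rel T, two_factor e f /\ num_cycles f <= 2.
Proof.
have [esym eirr] := He.
have [x0 _|T0] := pickP (@predT T); last first.
  (* The empty graph is its own 2-factor, without cycles. *)
  exists e; split; first by split=> // x; have := T0 x.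
  by rewrite /num_cycles /n_comp_mem eq_card0 // => x; have := T0 x.
have independent_small I : independent e I -> forall v, v \in I -> #|I| < degree e v.
  move=> indI v vI; have I0 : I != set0 by apply/set0Pn; exists v.
  have [_ /(_ v vI)] := delta_min e I0; apply: leq_trans.
  have := Hdelta I I0 indI; have : 0 < #|I| by rewrite card_gt0.
  by clear; lia.
apply: two_cycles_two_factor => //; apply: two_cycles_exist => // x y z u3 xy xz yz.
have ind3 : independent e [set w in [:: x; y; z]].
  have sub a b : a \in [:: x; y; z] -> b \in [:: x; y; z] -> ~~ e a b.
    rewrite !inE => /or3P[]/eqP-> /or3P[]/eqP->; by rewrite ?eirr // esym.
  apply/forall_inP => a; rewrite in_set => a3.
  by apply/forall_inP => b; rewrite in_set => b3; apply: sub.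
have card3 : #|[set w in [:: x; y; z]]| = 3 by rewrite cardsE (card_uniqP u3).
have sum3 : degree_sum e [set w in [:: x; y; z]] = degree e x + degree e y + degree e z.
  rewrite /degree_sum (eq_bigl [in [:: x; y; z]]) => [|w]; last by rewrite in_set.
  by rewrite -big_uniq //= !big_cons big_nil addn0 addnA.
case sigma: (sigma3 e) Hsigma => [m|] /=; rewrite Hn.
  have [_ /(_ [set w in [:: x; y; z]])] := sigma3_min sigma.
  by rewrite ind3 card3 sum3 => /(_ isT) le_m /leq_trans->.
move=> _; have := (sigma3_infinite e).1 sigma.
by rewrite ltnNge -[3]card3 /alpha (leq_bigmax_cond (F := fun I : {set T} => #|I|) _ ind3).
Qed.
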